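(* For $k\ge1$ let $\rho_k=(k,k-1,\ldots,2,1)$, and $\rho_0=\emptyset$. (1) For a positive integer $n$, $$P^{\mathbb L}_{\rho_{n-1}}(x_1,\ldots,x_n|\mathbf b)=\Big(\prod_{1\le i<j\le n}(x_i+_Fx_j)\Big)s^{\mathbb L}_\emptyset(x_1,\ldots,x_n|\mathbf b),$$ $$Q^{\mathbb L}_{\rho_n}(x_1,\ldots,x_n|\mathbf b)=\Big(\prod_{1\le i\le j\le n}(x_i+_Fx_j)\Big)s^{\mathbb L}_\emptyset(x_1,\ldots,x_n|\mathbf b).$$ (2) For a positive integer $n$ and a partition $\lambda=(\lambda_1,\ldots,\lambda_n)\in\mathcal P_n$, $$P^{\mathbb L}_{\rho_{n-1}+\lambda}(x_1,\ldots,x_n|\mathbf b)=\Big(\prod_{1\le i<j\le n}(x_i+_Fx_j)\Big)s^{\mathbb L}_\lambda(x_1,\ldots,x_n|\mathbf b),$$ $$Q^{\mathbb L}_{\rho_n+\lambda}(x_1,\ldots,x_n|\mathbf b)=\Big(\prod_{1\le i\le j\le n}(x_i+_Fx_j)\Big)s^{\mathbb L}_\lambda(x_1,\ldots,x_n|\mathbf b).$$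
   Context: $\mathbb L$ is the Lazard ring with universal formal group law $F_{\mathbb L}(u,v)=u+v+\sum_{i,j\ge1}a_{i,j}u^iv^j$; $a+_Fb=F_{\mathbb L}(a,b)$ and $\overline a\in\mathbb L[[a]]$ is the formal inverse ($a+_F\overline a=0$). $\mathbf b=(b_1,b_2,\ldots)$ are parameters. For $k\ge1$ put $[t|\mathbf b]^k=\prod_{i=1}^k(t+_Fb_i)$, $[[t|\mathbf b]]^k=(t+_Ft)[t|\mathbf b]^{k-1}$, with $[t|\mathbf b]^0=[[t|\mathbf b]]^0=1$. For $\lambda=(\lambda_1,\ldots,\lambda_r)$ put $[\mathbf x|\mathbf b]^\lambda=\prod_{i=1}^r[x_i|\mathbf b]^{\lambda_i}$, $[[\mathbf x|\mathbf b]]^\lambda=\prod_{i=1}^r[[x_i|\mathbf b]]^{\lambda_i}$. For a strict partition $\lambda=(\lambda_1>\cdots>\lambda_r>0)$ with $r\le n$, $$P^{\mathbb L}_\lambda(x_1,\ldots,x_n|\mathbf b)=\frac1{(n-r)!}\sum_{w\in S_n}w\Big[[\mathbf x|\mathbf b]^\lambda\prod_{i=1}^r\prod_{j=i+1}^n\frac{x_i+_Fx_j}{x_i+_F\overline x_j}\Big],$$ and $Q^{\mathbb L}_\lambda(x_1,\ldots,x_n|\mathbf b)$ is defined by the same formula with $[[\mathbf x|\mathbf b]]^\lambda$ in place of $[\mathbf x|\mathbf b]^\lambda$; $S_n$ permutes only the variables $x_1,\ldots,x_n$. $\mathcal P_n$ is the set of partitions $\lambda_1\ge\cdots\ge\lambda_n\ge0$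 of length at most $n$. Partitions are added componentwise after padding with zeros. For $\lambda\in\mathcal P_n$ the universal factorial Schur function is $$s^{\mathbb L}_\lambda(x_1,\ldots,x_n|\mathbf b)=\sum_{w\in S_n}w\left[\frac{[\mathbf x|\mathbf b]^{\lambda+\rho_{n-1}}}{\prod_{1\le i<j\le n}(x_i+_F\overline x_j)}\right].$$ *)

(* Defs.v *)
From HB Require Import structures.
From mathcomp Require Import all_boot all_order all_algebra all_fingroup finmap.
From mathcomp Require Import generic_quotient ring_quotient.
From mathcomp Require Import monalg.
From mathcomp Require Import boolp classical_sets.
From mathcomp Require Import ring.

Set Implicit Arguments.
Unset Strict Implicit.
Unset Printing Implicit Defensive.

Import GRing.Theory.

Local Open Scope ring_scope.

(* ------------------------------------------------------------------------ *)
(* Formal power series over R in an arbitrary (possibly infinite) set I of   *)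
(* variables: all functions from monomials (finitely supported exponents)    *)
(* to R, with the Cauchy product.                                            *)

Section Factorizations.
Variable I : choiceType.
Implicit Types m d : {cmonom I}.

(* Contains every divisor of m; the sum over factorizations filters out the  *)
(* other candidates.                                                         *)
Definition mdiv_candidates m : seq {cmonom I} :=
  [seq [cmonom (h i : nat) | i : finsupp m]%M
     | h : {ffun finsupp m -> 'I_(mdeg m).+1}].

Definition mfact m : seq ({cmonom I} * {cmonom I}) :=
  undup [seq p <- [seq (d, e) | d <- mdiv_candidates m,
                                e <- mdiv_candidates m] | mmul p.1 p.2 == m].

Lemma leq_mdeg m i : (m i <= mdeg m)%N.
Proof.
rewrite mdegE; case: (mdomP m i) => // mi.
by rewrite (big_fsetD1 i) //= leq_addr.
Qed.

Lemma mem_mdiv_candidates m d :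
  (forall i, d i <= m i)%N -> d \in mdiv_candidates m.
Proof.
move=> le_dm; apply/mapP.
exists [ffun i : finsupp m => inord (d (val i))]; first by rewrite mem_enum.
apply/eqP/cmP => i; rewrite cmE.
rewrite fsfun_ffun; case: insubP => [u _ uE|] /=.
  by rewrite ffunE inordK ?uE // ltnS (leq_trans (le_dm i)) ?leq_mdeg.
by rewrite -cmE_eq0 => /eqP mi0; move: (le_dm i); rewrite mi0 leqn0 => /eqP.
Qed.

Lemma mem_mfact m p : (p \in mfact m) = (mmul p.1 p.2 == m).
Proof.
rewrite mem_undup mem_filter; case: eqP => //= <-.
case: p => d e; apply/allpairsP; exists (d, e); split => //=;
  by apply: mem_mdiv_candidates => i; rewrite cmM ?leq_addr ?leq_addl.
Qed.

Lemma mfact_uniq m : uniq (mfact m). Proof. exact: undup_uniq. Qed.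

End Factorizations.

Record fps (I : choiceType) (R : Type) : Type :=
  Fps { fps_coef : {cmonom I} -> R }.

Notation "{ 'fps' R [ I ] }" := (fps I R)
  (at level 0, R, I at level 2, format "{ 'fps'  R [ I ] }") : type_scope.

HB.instance Definition _ (I : choiceType) (R : Type) := gen_eqMixin (fps I R).
HB.instance Definition _ (I : choiceType) (R : Type) :=
  gen_choiceMixin (fps I R).

Section FpsRing.
Variables (I : choiceType) (R : comNzRingType).
Local Notation S := {fps R[I]}.
Local Notation coef := (@fps_coef I R).
Implicit Types (f g h : S) (m : {cmonom I}).

Lemma fpsP f g : (forall m, coef f m = coef g m) -> f = g.
Proof. by case: f g => [f] [g] /= fg; congr Fps; apply: funext. Qed.

Definition fps_zero : S := Fps (fun=> 0).
Definition fps_opp f : S := Fps (fun m => - coef f m).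
Definition fps_add f g : S := Fps (fun m => coef f m + coef g m).
Definition fpsC (c : R) : S := Fps (fun m => if m == mone then c else 0).
Definition fps_mul f g : S :=
  Fps (fun m => \sum_(p <- mfact m) coef f p.1 * coef g p.2).

Definition fpsX (i : I) : S := Fps (fun m => (m == ucm i)%:R).

Lemma fps_addA : associative fps_add.
Proof. by move=> f g h; apply: fpsP => m /=; rewrite addrA. Qed.
Lemma fps_addC : commutative fps_add.
Proof. by move=> f g; apply: fpsP => m /=; rewrite addrC. Qed.
Lemma fps_add0 : left_id fps_zero fps_add.
Proof. by move=> f; apply: fpsP => m /=; rewrite add0r. Qed.
Lemma fps_addN : left_inverse fps_zero fps_opp fps_add.
Proof. by move=> f; apply: fpsP => m /=; rewrite addNr. Qed.

HB.instance Definition _ := GRing.isZmodule.Build S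
  fps_addA fps_addC fps_add0 fps_addN.

Lemma fps_mulC : commutative fps_mul.
Proof.
move=> f g; apply: fpsP => m /=.
pose sw (p : {cmonom I} * {cmonom I}) := (p.2, p.1).
have swK : involutive sw by case.
have swP : perm_eq (mfact m) [seq sw p | p <- mfact m].
  apply: uniq_perm; rewrite ?map_inj_uniq ?mfact_uniq //; first exact: inv_inj.
  move=> p; rewrite -[p in RHS]swK mem_map; last exact: inv_inj.
  by rewrite !mem_mfact /= mulmC.
rewrite (perm_big _ swP) big_map.
by apply: eq_bigr => p _; rewrite mulrC.
Qed.

Lemma fps_mul1 : left_id (fpsC 1) fps_mul.
Proof.
move=> f; apply: fpsP => m /=.
rewrite (bigD1_seq (mone, m)) ?mfact_uniq ?mem_mfact /= ?mul1m //=.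
rewrite eqxx mul1r big1_seq ?addr0 // => -[d e] /= /andP[ne].
rewrite mem_mfact /= => /eqP de; case: (eqVneq d mone) => [d1|_].
  by move: de ne; rewrite d1 mul1m => ->; rewrite eqxx.
by rewrite mul0r.
Qed.

Lemma fps_mulDl : left_distributive fps_mul fps_add.
Proof.
move=> f g h; apply: fpsP => m /=.
by rewrite -big_split; apply: eq_bigr => p _; rewrite mulrDl.
Qed.

Lemma fps_mulA : associative fps_mul.
Proof.
move=> f g h; apply: fpsP => m /=.
pose M := {cmonom I}.
pose F (t : M * M * M) := coef f t.1.1 * coef g t.1.2 * coef h t.2.
pose s1 := [seq (p.1, q.1, q.2) | p <- mfact m, q <- mfact p.2].
pose s2 := [seq (q.1, q.2, p.2) | p <- mfact m, q <- mfact p.1].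
have -> : \sum_(p <- mfact m) coef f p.1 *
            (\sum_(q <- mfact p.2) coef g q.1 * coef h q.2) = \sum_(t <- s1) F t.
  rewrite big_allpairs_dep /=; apply: eq_bigr => p _.
  by rewrite big_distrr; apply: eq_bigr => q _; rewrite /F /= mulrA.
have -> : \sum_(p <- mfact m)
            (\sum_(q <- mfact p.1) coef f q.1 * coef g q.2) * coef h p.2 =
            \sum_(t <- s2) F t.
  rewrite big_allpairs_dep /=; apply: eq_bigr => p _.
  by rewrite big_distrl; apply: eq_bigr.
apply: perm_big; apply: uniq_perm.
- apply: allpairs_uniq_dep => [|p _|]; rewrite ?mfact_uniq //.
  move=> _ _ /allpairsPdep[[a b][[c d][+ + ->]]]
    /allpairsPdep[[a' b'][[c' d'][+ + ->]]] /=.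
  by rewrite !mem_mfact /= => _ /eqP bE _ /eqP b'E [*]; subst.
- apply: allpairs_uniq_dep => [|p _|]; rewrite ?mfact_uniq //.
  move=> _ _ /allpairsPdep[[a b][[c d][+ + ->]]]
    /allpairsPdep[[a' b'][[c' d'][+ + ->]]] /=.
  by rewrite !mem_mfact /= => _ /eqP bE _ /eqP b'E [*]; subst.
move=> [[a b] c]; apply/allpairsPdep/allpairsPdep => /=.
- move=> [[a1 b1] [[c1 d1]]] /= [].
  rewrite !mem_mfact /= => /eqP <- /eqP <- [-> -> ->].
  by exists (mmul a1 c1, d1), (a1, c1); rewrite !mem_mfact /= mulmA !eqxx.
- move=> [[a1 b1] [[c1 d1]]] /= [].
  rewrite !mem_mfact /= => /eqP <- /eqP <- [-> -> ->].
  by exists (c1, mmul d1 b1), (d1, b1); rewrite !mem_mfact /= mulmA !eqxx.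
Qed.

Lemma fps_1neq0 : fpsC 1 != fps_zero.
Proof.
apply/eqP => /(congr1 (fun f => coef f mone)) /= /eqP.
by rewrite eqxx oner_eq0.
Qed.

HB.instance Definition _ := GRing.Zmodule_isComNzRing.Build S
  fps_mulA fps_mulC fps_mul1 fps_mulDl fps_1neq0.

Lemma fps_coefM f g m :
  coef (f * g) m = \sum_(p <- mfact m) coef f p.1 * coef g p.2.
Proof. by []. Qed.

Lemma fps_coefD f g m : coef (f + g) m = coef f m + coef g m.
Proof. by []. Qed.

Lemma fps_coefN f m : coef (- f) m = - coef f m.
Proof. by []. Qed.

End FpsRing.

Arguments fpsX {I R} i.
Arguments fps_mul : simpl never.

(* ------------------------------------------------------------------------ *)
(* F(f,g) = f + g + \sum_(i,j >= 1) a_(i,j) f^i g^j, where a i j stands for  *)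
(* a_(i+1,j+1).  It is meant for f and g without constant term: then f^i g^j *)
(* has order at least i + j, so only finitely many terms contribute to the   *)
(* coefficient of a given monomial, all of them in the sums below.           *)

Section FormalSum.
Variables (R : comNzRingType) (a : nat -> nat -> R) (I : choiceType).
Implicit Types (f g : {fps R[I]}).

Definition fgl_add f g : {fps R[I]} :=
  Fps (fun m => fps_coef f m + fps_coef g m +
    \sum_(i < mdeg m) \sum_(j < mdeg m)
       a i j * fps_coef (f ^+ i.+1 * g ^+ j.+1) m).

Definition fgl_opp f : {fps R[I]} :=
  xget 0 [set g | fps_coef g mone = 0 /\ fgl_add f g = 0]%classic.

(* F(f,g) = 0 iff g is a fixpoint of the contraction H f.                    *)
Let H f g : {fps R[I]} :=
  Fps (fun m => - (fps_coef f m + \sum_(i < mdeg m) \sum_(j < mdeg m)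
       a i j * fps_coef (f ^+ i.+1 * g ^+ j.+1) m)).

Let HP f g : fgl_add f g = 0 <-> H f g = g.
Proof.
split=> [E | E]; apply: fpsP => m /=.
  have := congr1 (fun h => fps_coef h m) E => /= /eqP.
  by rewrite addrAC addr_eq0 => /eqP ->; rewrite opprK.
have /= gE := congr1 (fun h => fps_coef h m) E.
by rewrite addrAC -[X in _ + X]gE subrr.
Qed.

Let agree d (g h : {fps R[I]}) :=
  forall m, (mdeg m < d)%N -> fps_coef g m = fps_coef h m.

Let agreeX d g h k : agree d g h -> agree d (g ^+ k) (h ^+ k).
Proof.
move=> gh; elim: k => [|k IHk] m lt_md; first by rewrite !expr0.
rewrite !exprS !fps_coefM; apply: eq_big_seq => -[p q] /=.
rewrite mem_mfact => /= /eqP pq; move: lt_md; rewrite -pq mdegM => lt_md.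
by rewrite gh ?IHk // (leq_ltn_trans _ lt_md) ?leq_addl ?leq_addr.
Qed.

Let agreeH d f g h : fps_coef f mone = 0 ->
  agree d g h -> agree d.+1 (H f g) (H f h).
Proof.
move=> f0 gh m lt_md /=; congr (- (_ + _)).
apply: eq_bigr => i _; apply: eq_bigr => j _; congr (_ * _).
apply: eq_big_seq => -[p q] /=.
rewrite mem_mfact => /= /eqP pq; have {}lt_md : (mdeg p + mdeg q <= d)%N by rewrite -mdegM pq.
case: (eqVneq p mone) => [->|p1].
  suff -> : fps_coef (f ^+ i.+1) mone = 0 by rewrite !mul0r.
  rewrite exprS fps_coefM big1_seq // => -[u v] /=; rewrite mem_mfact /=.
  by rewrite cmM_eq1 => /andP[/eqP-> _]; rewrite f0 mul0r.
rewrite (agreeX _ gh) // (leq_trans _ lt_md) //.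
by rewrite -[X in (X < _)%N]add0n ltn_add2r lt0n mdeg_eq0.
Qed.

Let H_fix f : fps_coef f mone = 0 -> exists g, H f g = g.
Proof.
move=> f0; have [u uS] : exists u, forall k, u k.+1 = H f (u k).
  by exists (fun k => iter k (H f) 0) => k; rewrite iterS.
have u_agree k l : agree k (u k) (u (k + l)%N).
  elim: k => [|k IHk]; first by move=> m.
  by rewrite addSn !uS; apply: agreeH.
have [g gE] : exists g : {fps R[I]},
    forall m, fps_coef g m = fps_coef (u (mdeg m).+1) m.
  by exists (Fps (fun m => fps_coef (u (mdeg m).+1) m)).
have g_agree k : agree k g (u k).
  move=> m lt_mk; rewrite gE -(subnKC lt_mk).
  by rewrite -(u_agree (mdeg m).+1 _ m).
exists g; apply: fpsP => m.
apply: etrans (agreeH f0 (g_agree (mdeg m)) (ltnSn _)) _.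
by rewrite -uS gE.
Qed.

Let H_uniq f g h : fps_coef f mone = 0 -> H f g = g -> H f h = h -> g = h.
Proof.
move=> f0 Hg Hh; suff gh d : agree d g h by apply: fpsP => m; apply: (gh _.+1).
elim: d => [|d IHd]; first by move=> m.
by rewrite -Hg -Hh; apply: agreeH.
Qed.

Lemma fgl_oppP f : fps_coef f mone = 0 ->
  fps_coef (fgl_opp f) mone = 0 /\ fgl_add f (fgl_opp f) = 0.
Proof.
move=> f0; rewrite /fgl_opp; case: xgetP => [g _ [] //|noex].
have [g Hg] := H_fix f0; case: (noex g); split; last exact/HP.
by rewrite -Hg /= f0 mdeg1 big_ord0 addr0 oppr0.
Qed.

Lemma fgl_opp_unique f g : fps_coef f mone = 0 ->
  fgl_add f g = 0 -> g = fgl_opp f.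
Proof.
move=> f0 /HP Hg; have [_ /HP Hopp] := fgl_oppP f0.
exact: (H_uniq f0).
Qed.

End FormalSum.

(* ------------------------------------------------------------------------ *)
(* The coefficients of F(u,v) - F(v,u) and of F(F(x,y),z) - F(x,F(y,z)):     *)
(* these elements vanish iff F is a commutative formal group law.  The unit  *)
(* law F(u,0) = u holds by the shape of F.                                   *)

Section FglRelations.
Variables (R : comNzRingType) (a : nat -> nat -> R).
Local Notation F := (@fgl_add R a 'I_3).
Local Notation x := (fpsX (inord 0) : {fps R['I_3]}).
Local Notation y := (fpsX (inord 1) : {fps R['I_3]}).
Local Notation z := (fpsX (inord 2) : {fps R['I_3]}).

Inductive fgl_relator : R -> Prop :=
| FglComm i j : fgl_relator (a i j - a j i)
| FglAssoc m : fgl_relator (fps_coef (F (F x y) z - F x (F y z)) m).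

Inductive fgl_ideal_prop : R -> Prop :=
| FglIdeal0 : fgl_ideal_prop 0
| FglIdealD c r p :
    fgl_relator r -> fgl_ideal_prop p -> fgl_ideal_prop (c * r + p).

Definition fgl_ideal : pred R := fun p => `[< fgl_ideal_prop p >].

Lemma fgl_ideal_closed (S : comNzRingType) (eps : {rmorphism R -> S}) :
  (forall i j, eps (a i j) = 0) -> idealr_closed fgl_ideal.
Proof.
move=> eps0.
have epsF (f g : {fps R['I_3]}) m :
    eps (fps_coef (F f g) m) = eps (fps_coef f m) + eps (fps_coef g m).
  rewrite [fps_coef (F f g) m]/= !rmorphD rmorph_sum big1 ?addr0 // => i _.
  by rewrite rmorph_sum big1 // => j _; rewrite rmorphM eps0 mul0r.
have eps_assoc (f g h : {fps R['I_3]}) m :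
    eps (fps_coef (F (F f g) h) m) = eps (fps_coef (F f (F g h)) m).
  by move: (@fgl_add R a 'I_3) epsF => G epsG; rewrite !epsG addrA.
have eps_rel r : fgl_relator r -> eps r = 0.
  case=> [i j|m]; first by rewrite rmorphB !eps0 subrr.
  rewrite fps_coefD fps_coefN rmorphB; apply/eqP; rewrite subr_eq0.
  exact/eqP/eps_assoc.
have eps_ideal p : fgl_ideal_prop p -> eps p = 0.
  elim=> [|c r q rel _ IHq]; first by rewrite rmorph0.
  by rewrite rmorphD rmorphM (eps_rel _ rel) mulr0 IHq addr0.
split.
- exact/asboolP/FglIdeal0.
- apply/asboolPn => /eps_ideal/eqP.
  by rewrite rmorph1 oner_eq0.
move=> c p q /asboolP Ip /asboolP Iq; apply/asboolP.
elim: Ip => [|d r p' rel _ IHp]; first by rewrite mulr0 add0r.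
by rewrite mulrDr mulrA -addrA; apply: FglIdealD.
Qed.

End FglRelations.

(* The Lazard ring, presented as Z[a_(i,j) : i,j >= 1] modulo the above      *)
(* relations.                                                                *)

Definition lazard_poly : comNzRingType :=
  {malg int[{cmonom (nat * nat)%type}]}.

(* the variable a_(i+1,j+1) *)
Definition lazard_gen (i j : nat) : lazard_poly := << ucm (i, j) >>.

Definition lazard_ideal : pred lazard_poly := fgl_ideal lazard_gen.

Lemma lazard_idealr_closed : idealr_closed lazard_ideal.
Proof.
pose eps : {rmorphism {malg int[{cmonom (nat * nat)%type}]} -> int} :=
  mcoeff mone.
apply: (@fgl_ideal_closed lazard_poly lazard_gen int eps) => i j.
have E : mcoeff mone (<< ucm (i, j) >> :
  {malg int[{cmonom (nat * nat)%type}]}) = 0 by rewrite mcoeffU1 cm1_eq1.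
exact: E.
Qed.

HB.instance Definition _ :=
  isIdealr.Build lazard_poly lazard_ideal lazard_idealr_closed.

Definition lazard_quot : Type :=
  {ideal_quot (lazard_ideal : idealr lazard_poly)}.
HB.instance Definition _ := GRing.ComNzRing.on lazard_quot.
Definition lazard : comNzRingType := lazard_quot.

(* the image of a_(i+1,j+1) *)
Definition lazard_coef (i j : nat) : lazard :=
  (\pi_({ideal_quot (lazard_ideal : idealr lazard_poly)}) (lazard_gen i j))%qT.

Notation "f +_F g" := (fgl_add lazard_coef f g)
  (at level 50, left associativity) : ring_scope.
(* f +_F \bar g *)
Notation "f -_F g" := (fgl_add lazard_coef f (fgl_opp lazard_coef g))
  (at level 50, left associativity) : ring_scope.

(* ------------------------------------------------------------------------ *)
(* Total ring of fractions of a commutative ring A: fractions whose          *)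
(* denominator is a nonzerodivisor (GRing.lreg).  It is the field of         *)
(* fractions when A is an integral domain; A always embeds in it.            *)

Section Fractions.
Variable A : comNzRingType.

Inductive tratio := MkTRatio { tfrac :> A * A; _ : `[< GRing.lreg tfrac.2 >] }.

HB.instance Definition _ := [isSub for tfrac].
HB.instance Definition _ := [Choice of tratio by <:].
Implicit Types x y z : tratio.

Lemma tratioP x : GRing.lreg x.2. Proof. by case: x => x /= /asboolP. Qed.
Arguments tratioP : clear implicits.

Definition TRatio (n d : A) (d_reg : GRing.lreg d) : tratio :=
  @MkTRatio (n, d) (introT (asboolP _) d_reg).

Definition tequiv x y := x.1 * y.2 == x.2 * y.1.

Lemma tequiv_refl : reflexive tequiv.
Proof. by move=> x; rewrite /tequiv mulrC. Qed.
Lemma tequiv_sym : symmetric tequiv.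
Proof.
by move=> x y; rewrite /tequiv eq_sym [x.2 * _]mulrC [x.1 * _]mulrC.
Qed.
Lemma tequiv_trans : transitive tequiv.
Proof.
move=> y x z; rewrite /tequiv => /eqP xy /eqP yz; apply/eqP.
apply: (tratioP y); transitivity ((x.1 * y.2) * z.2); first by ring.
by rewrite xy -mulrA yz; ring.
Qed.
Canonical tequiv_equiv := EquivRel tequiv tequiv_refl tequiv_sym tequiv_trans.

Local Open Scope quotient_scope.

Definition totfrac := {eq_quot tequiv}.
HB.instance Definition _ : EqQuotient _ tequiv totfrac := EqQuotient.on totfrac.
HB.instance Definition _ := Choice.on totfrac.

Definition mkfrac (x : tratio) : totfrac := \pi_totfrac x.

Lemma mkfracP x y : mkfrac x = mkfrac y <-> x.1 * y.2 = x.2 * y.1.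
Proof. by split=> [/eqmodP /eqP|E] //; apply/eqmodP/eqP. Qed.

Lemma mkfracK (q : totfrac) : mkfrac (repr q) = q.
Proof. exact: reprK. Qed.

Lemma reprfrac x : x.1 * (repr (mkfrac x)).2 = x.2 * (repr (mkfrac x)).1.
Proof. by apply/mkfracP; rewrite mkfracK. Qed.

Lemma fracW (P : totfrac -> Prop) : (forall x, P (mkfrac x)) -> forall q, P q.
Proof. by move=> Px q; rewrite -(mkfracK q). Qed.

Definition addt x y : tratio :=
  TRatio (x.1 * y.2 + y.1 * x.2) (lregM (tratioP x) (tratioP y)).
Definition oppt x : tratio := TRatio (- x.1) (tratioP x).
Definition mult x y : tratio :=
  TRatio (x.1 * y.1) (lregM (tratioP x) (tratioP y)).
Definition invt x : tratio :=
  if pselect (GRing.lreg x.1) is left x_reg then TRatio x.2 x_reg else x.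

Definition totfrac_add (p q : totfrac) := mkfrac (addt (repr p) (repr q)).
Definition totfrac_opp (p : totfrac) := mkfrac (oppt (repr p)).
Definition totfrac_mul (p q : totfrac) := mkfrac (mult (repr p) (repr q)).
Definition totfrac_inv (p : totfrac) := mkfrac (invt (repr p)).
Definition totfrac_unit : pred totfrac :=
  fun p => `[< GRing.lreg (repr p).1 >].
Definition tofrac (c : A) : totfrac := mkfrac (TRatio c (@lreg1 A)).

Lemma totfrac_addE x y :
  totfrac_add (mkfrac x) (mkfrac y) = mkfrac (addt x y).
Proof.
apply/mkfracP => /=; move: (reprfrac x) (reprfrac y).
move: (x.1) (x.2) (y.1) (y.2) (repr (mkfrac x)).1 (repr (mkfrac x)).2
      (repr (mkfrac y)).1 (repr (mkfrac y)).2 => a b c d a' b' c' d' E1 E2.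
transitivity ((b * a') * (d * d') + (d * c') * (b * b')); first by ring.
by rewrite -E1 -E2; ring.
Qed.

Lemma totfrac_oppE x : totfrac_opp (mkfrac x) = mkfrac (oppt x).
Proof. by apply/mkfracP => /=; rewrite mulNr mulrN mulrC -reprfrac mulrC. Qed.

Lemma totfrac_mulE x y :
  totfrac_mul (mkfrac x) (mkfrac y) = mkfrac (mult x y).
Proof.
apply/mkfracP => /=; move: (reprfrac x) (reprfrac y).
move: (x.1) (x.2) (y.1) (y.2) (repr (mkfrac x)).1 (repr (mkfrac x)).2
      (repr (mkfrac y)).1 (repr (mkfrac y)).2 => a b c d a' b' c' d' E1 E2.
transitivity ((b * a') * (d * c')); first by ring.
by rewrite -E1 -E2; ring.
Qed.

Lemma totfrac_addA : associative totfrac_add.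
Proof.
elim/fracW => x; elim/fracW => y; elim/fracW => z; rewrite !totfrac_addE.
by apply/mkfracP => /=; ring.
Qed.
Lemma totfrac_addC : commutative totfrac_add.
Proof.
elim/fracW => x; elim/fracW => y; rewrite !totfrac_addE.
by apply/mkfracP => /=; ring.
Qed.
Lemma totfrac_add0 : left_id (tofrac 0) totfrac_add.
Proof.
by elim/fracW => x; rewrite /tofrac totfrac_addE; apply/mkfracP => /=; ring.
Qed.
Lemma totfrac_addN : left_inverse (tofrac 0) totfrac_opp totfrac_add.
Proof.
elim/fracW => x; rewrite totfrac_oppE /tofrac totfrac_addE.
by apply/mkfracP => /=; ring.
Qed.

HB.instance Definition _ := GRing.isZmodule.Build totfrac
  totfrac_addA totfrac_addC totfrac_add0 totfrac_addN.

Lemma totfrac_mulA : associative totfrac_mul.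
Proof.
elim/fracW => x; elim/fracW => y; elim/fracW => z; rewrite !totfrac_mulE.
by apply/mkfracP => /=; ring.
Qed.
Lemma totfrac_mulC : commutative totfrac_mul.
Proof.
elim/fracW => x; elim/fracW => y; rewrite !totfrac_mulE.
by apply/mkfracP => /=; ring.
Qed.
Lemma totfrac_mul1 : left_id (tofrac 1) totfrac_mul.
Proof.
by elim/fracW => x; rewrite /tofrac totfrac_mulE; apply/mkfracP => /=; ring.
Qed.
Lemma totfrac_mulDl : left_distributive totfrac_mul totfrac_add.
Proof.
elim/fracW => x; elim/fracW => y; elim/fracW => z.
rewrite !(totfrac_addE, totfrac_mulE).
by apply/mkfracP => /=; ring.
Qed.
Lemma totfrac_1neq0 : tofrac 1 != tofrac 0.
Proof. by apply/eqP => /mkfracP /= /eqP; rewrite !mul1r oner_eq0. Qed.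

HB.instance Definition _ := GRing.Zmodule_isComNzRing.Build totfrac
  totfrac_mulA totfrac_mulC totfrac_mul1 totfrac_mulDl totfrac_1neq0.

Lemma totfrac_mulV : {in totfrac_unit, left_inverse 1 totfrac_inv *%R}.
Proof.
move=> p /asboolP p_reg; rewrite /totfrac_inv /invt.
case: pselect => // p_reg'; rewrite -[p in X in _ * X]mkfracK.
by rewrite [LHS]totfrac_mulE; apply/mkfracP => /=; ring.
Qed.
Lemma totfrac_unitP p q : q * p = 1 -> totfrac_unit p.
Proof.
move=> qp; have /mkfracP /= : mkfrac (mult (repr q) (repr p)) = tofrac 1 := qp.
rewrite !mulr1 => E; apply/asboolP; apply: (@GRing.lregMl _ (repr q).1).
by rewrite E; apply: lregM; apply: tratioP.
Qed.
Lemma totfrac_inv_out : {in [predC totfrac_unit], totfrac_inv =1 id}.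
Proof.
move=> p /asboolPn np; rewrite /totfrac_inv /invt.
by case: pselect => // _; rewrite mkfracK.
Qed.

HB.instance Definition _ := GRing.ComNzRing_hasMulInverse.Build totfrac
  totfrac_mulV totfrac_unitP totfrac_inv_out.

Lemma tofrac_inj : injective tofrac.
Proof. by move=> c d /mkfracP /=; rewrite mulr1 mul1r. Qed.

Lemma tofrac_is_zmod_morphism : zmod_morphism tofrac.
Proof.
move=> c d; rewrite [- tofrac d]totfrac_oppE [RHS]totfrac_addE.
by apply/mkfracP => /=; ring.
Qed.
Lemma tofrac_is_monoid_morphism : monoid_morphism tofrac.
Proof.
by split=> // c d; rewrite [RHS]totfrac_mulE; apply/mkfracP => /=; ring.
Qed.
HB.instance Definition _ :=
  GRing.isZmodMorphism.Build A totfrac tofrac tofrac_is_zmod_morphism.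
HB.instance Definition _ :=
  GRing.isMonoidMorphism.Build A totfrac tofrac tofrac_is_monoid_morphism.

Lemma tofrac_unit (c : A) : GRing.lreg c -> tofrac c \is a GRing.unit.
Proof.
move=> c_reg; have E : mkfrac (TRatio 1 c_reg) * tofrac c = 1.
  by rewrite [LHS]totfrac_mulE; apply/mkfracP => /=; ring.
exact: (totfrac_unitP E).
Qed.

End Fractions.

Notation "{ 'totfrac' A }" := (totfrac A)
  (at level 0, format "{ 'totfrac'  A }") : type_scope.
Notation "c %:F" := (tofrac c) : ring_scope.

(* ------------------------------------------------------------------------ *)
(* Partitions are sequences of natural numbers, trailing zeros being         *)
(* irrelevant.                                                               *)

Definition plength (lam : seq nat) : nat := count (leq 1) lam.

Definition padd (lam mu : seq nat) : seq nat :=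
  mkseq (fun i => nth 0 lam i + nth 0 mu i)%N (maxn (size lam) (size mu)).

Definition rho (k : nat) : seq nat := rev (iota 1 k).

(* ------------------------------------------------------------------------ *)
(* The functions are defined for arbitrary arguments x, b in a ring of power *)
(* series over the Lazard ring, so that a permutation w of the variables     *)
(* acts on an expression in x by substituting x \o w.  They take values in   *)
(* the total ring of fractions, where the denominators are invertible:       *)
(* x_i +_F \bar x_j is a unit times x_i - x_j for i != j, and L is            *)
(* torsion-free by Lazard's theorem.  The parameter b_k is b k.-1, and the   *)
(* variable x_(i+1) is x i.                                                  *)

Section FactorialFunctions.
Variables (n : nat) (I : choiceType).
Local Notation A := {fps lazard[I]}.
Implicit Types (t : A) (x : 'I_n -> A) (b : nat -> A) (lam : seq nat).

Definition fpow b t (k : nat) : A := \prod_(i < k) (t +_F b i).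

Definition dfpow b t (k : nat) : A :=
  if k is k'.+1 then (t +_F t) * fpow b t k' else 1.

Definition fpows b x lam : A := \prod_(i < n) fpow b (x i) (nth 0%N lam i).

Definition dfpows b x lam : A := \prod_(i < n) dfpow b (x i) (nth 0%N lam i).

Definition hl_kernel (r : nat) x : {totfrac A} :=
  \prod_(i < n | (i < r)%N) \prod_(j < n | (i < j)%N)
    ((x i +_F x j)%:F / (x i -_F x j)%:F).

(* for strict partitions lam of length at most n *)
Definition univP lam x b : {totfrac A} :=
  ((n - plength lam)`!%:R)^-1 *
  \sum_(w : 'S_n)
     ((fpows b (x \o w) lam)%:F * hl_kernel (plength lam) (x \o w)).

Definition univQ lam x b : {totfrac A} :=
  ((n - plength lam)`!%:R)^-1 *
  \sum_(w : 'S_n)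
     ((dfpows b (x \o w) lam)%:F * hl_kernel (plength lam) (x \o w)).

(* for partitions lam of length at most n *)
Definition univs lam x b : {totfrac A} :=
  \sum_(w : 'S_n)
     ((fpows b (x \o w) (padd lam (rho n.-1)))%:F /
      (\prod_(i < n) \prod_(j < n | (i < j)%N)
          ((x \o w) i -_F (x \o w) j))%:F).

End FactorialFunctions.

(* The variables x_(i+1) and b_(k+1) of L[[x_1, ..., x_n, b_1, b_2, ...]].   *)

Definition xvar n (i : 'I_n) : {fps lazard[('I_n + nat)%type]} := fpsX (inl i).
Definition bvar n (k : nat) : {fps lazard[('I_n + nat)%type]} := fpsX (inr k).

(* Main.v *)
Require Import Defs.
From mathcomp Require Import all_boot all_order all_algebra all_fingroup.
From mathcomp Require Import finmap ring_quotient monalg boolp.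
From mathcomp Require Import zify.

Import GRing.Theory.
Local Open Scope ring_scope.

(* For strict partitions of length n - 1 or n the factor (n - r)! is 1 and    *)
(* the kernel runs over all pairs i < j.  Its numerator is symmetric in x and *)
(* leaves the sum over permutations, as do the factors x_i +_F x_i of Q; what *)
(* remains is the sum defining s.  Splitting the kernel into numerator and    *)
(* denominator requires x_i -_F x_j to be a nonzerodivisor for i != j, which  *)
(* is read off its linear part x_i - x_j.                                     *)

(** Each summand is compared separately. For [P] of [rho n.-1 + lam] the summand of [w] is the
    summand of [univs] times the product of the [x i +_F x j] over [i < j], permuted by [w];
    [prod_ltn_perm] removes [w] by commutativity of the formal group law. For [Q], [rho n] exceeds
    [rho n.-1] by one in each of the [n] entries, and [[[t|b]]^(k+1) = (t +_F t) [t|b]^k] turns this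
    excess into the diagonal factors. [hl_kernel_perm] does the factoring, and [fps_lreg] makes the
    quotients genuine. *)

Lemma nth_padd lam mu i :
  nth 0%N (padd lam mu) i = (nth 0%N lam i + nth 0%N mu i)%N.
Proof.
case: (ltnP i (maxn (size lam) (size mu))) => i_lt; first by rewrite nth_mkseq.
rewrite nth_default ?size_mkseq //.
by move: i_lt; rewrite geq_max => /andP[le_lam le_mu]; rewrite !nth_default.
Qed.

Lemma size_rho k : size (rho k) = k.
Proof. by rewrite size_rev size_iota. Qed.

Lemma nth_rho k i : nth 0%N (rho k) i = (k - i)%N.
Proof.
case: (ltnP i k) => i_k; last by rewrite nth_default ?size_rho //; lia.
by rewrite nth_rev ?size_iota // nth_iota; lia.
Qed.

Lemma leq_plength k mu :
  (forall i, (i < k)%N -> (0 < nth 0 mu i)%N) -> (k <= plength mu)%N.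
Proof.
case: k => // k mu_gt0; have k_size : (k < size mu)%N.
  by rewrite ltnNge; apply/negP => le; have := mu_gt0 k (ltnSn k);
     rewrite nth_default.
rewrite /plength -(cat_take_drop k.+1 mu) count_cat.
suff : all (leq 1) (take k.+1 mu).
  by rewrite all_count => /eqP ->; rewrite size_takel // leq_addr.
apply/(all_nthP 0%N) => i; rewrite size_takel // => i_k.
by rewrite nth_take // mu_gt0.
Qed.

Lemma prod_ltn_perm (R : comNzRingType) (n : nat) (G : 'I_n -> 'I_n -> R)
    (w : 'S_n) : (forall i j, G i j = G j i) ->
  \prod_(i < n) \prod_(j < n | (i < j)%N) G (w i) (w j) =
  \prod_(i < n) \prod_(j < n | (i < j)%N) G i j.
Proof.
move=> Gsym; rewrite !pair_big_dep /=.
(* [h s] is the action of [s] on unordered pairs, each represented by its increasing ordering;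
   [h w^-1] inverts [h w]. *)
pose h (s : 'S_n) (p : 'I_n * 'I_n) :=
  if (s p.1 < s p.2)%N then (s p.1, s p.2) else (s p.2, s p.1).
rewrite [RHS](reindex_onto (h w) (h w^-1%g)) => [|[i j] /= i_j]; last first.
  rewrite /h /=; case: (w^-1%g i < w^-1%g j)%N => /=;
    by rewrite !permKV ?i_j // ltnNge ltnW.
apply: eq_big => [[i j]|[i j] _] /=; last by rewrite /h /=; case: ifP.
have w_inj : ((w i : nat) == w j) = ((i : nat) == j).
  by rewrite !val_eqE (inj_eq perm_inj).
rewrite /h /=; case: (ltngtP (w i) (w j)) w_inj => /= w_ij ij;
  rewrite !permK; case: (ltngtP i j) ij => //= i_j _;
  rewrite ?w_ij ?ltnn ?eqxx //=; apply/esym/eqP => -[ij _];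
  by move: i_j; rewrite ij ltnn.
Qed.

Section FpsRegular.
Variables (I : choiceType) (R : comNzRingType).
Implicit Types (f g : {fps R[I]}) (m p : {cmonom I}) (i : I).

Lemma mdeg_le1 m : (mdeg m <= 1)%N -> m = mone \/ exists i, m = ucm i.
Proof.
move=> m_le1; case: (eqVneq m mone) => [|m_neq1]; [by left | right].
have [i mi] : exists i, (0 < m i)%N.
  apply: contrapT => no_i; move/eqP: m_neq1; apply; apply/eqP/cmP => i.
  rewrite cm1; apply/eqP; rewrite -leqn0 leqNgt; apply/negP => mi.
  by apply: no_i; exists i.
exists i; apply/eqP/cmP => j; rewrite cmU.
case: (eqVneq i j) => [<-|i_j].
  by apply/eqP; rewrite eqn_leq mi andbT (leq_trans (leq_mdeg m i)).
apply/eqP; rewrite -leqn0 leqNgt; apply/negP => mj.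
(* Summing over a support enlarged by [i] and [j] lets both exponents be split off, so the degree is
   at least 2. *)
have := mdegEw (fsubsetUr [fset i; j]%fset (finsupp m)).
rewrite (big_fsetD1 i) /=; last by rewrite !inE eqxx.
rewrite (big_fsetD1 j) /=; last by rewrite !inE eq_sym i_j eqxx orbT.
lia.
Qed.

(* Well-founded recursion on the weight of monomials giving X_i weight 1 and  *)
(* every other variable weight 2: the term X_i is the only one of weight < 2. *)
Lemma fps_lreg i g :
  fps_coef g mone = 0 -> fps_coef g (ucm i) = 1 -> GRing.lreg g.
Proof.
move=> g0 gi; apply: mulrI0_lreg => f gf0; apply: fpsP => m.
pose wt m := (mdeg m + (mdeg m - m i))%N.
have wtM p q : wt (mmul p q) = (wt p + wt q)%N.
  rewrite /wt mdegM cmM; have := leq_mdeg p i; have := leq_mdeg q i; lia.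
have wt_i : wt (ucm i) = 1%N by rewrite /wt mdegU cmUU.
have wt_ge2 p : p != mone -> p != ucm i -> (1 < wt p)%N.
  move=> p1 pi; rewrite /wt; case: (leqP (mdeg p) 1) => [|p_gt1]; last lia.
  case/mdeg_le1 => [p_eq|[k p_eq]]; first by rewrite p_eq eqxx in p1.
  rewrite p_eq mdegU cmU; case: eqVneq => [k_i|//].
  by rewrite p_eq k_i eqxx in pi.
have [k] := ubnP (wt m); elim: k m => // k IHk m wt_m.
(* This coefficient is that of [f] at [m] plus terms with [p] of weight at least 2, whose cofactor
   [q] is then lighter than [m]. *)
have : fps_coef (g * f) (mmul (ucm i) m) = 0 by rewrite gf0.
rewrite fps_coefM (bigD1_seq (ucm i, m)) ?mfact_uniq ?mem_mfact //=.
rewrite gi mul1r big1_seq ?addr0 // => -[p q] /= /andP[pq_neq].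
rewrite mem_mfact /= => /eqP pq.
case: (eqVneq p mone) => [->|p1]; first by rewrite g0 mul0r.
case: (eqVneq p (ucm i)) => [p_i|p_i].
  case/eqP: pq_neq; rewrite p_i; congr pair; apply/eqP/cmP => j.
  move/(congr1 (fun m : {cmonom I} => m j)): pq.
  by rewrite p_i !cmM => /addnI.
rewrite IHk ?mulr0 //; move: (wt_ge2 p p1 p_i) (wtM p q).
by rewrite pq wtM wt_i; lia.
Qed.

End FpsRegular.

Section FormalSumTheory.
Variables (R : comNzRingType) (a : nat -> nat -> R) (I : choiceType).
Implicit Types (f g : {fps R[I]}).

Lemma fgl_addC f g :
  (forall i j, a i j = a j i) -> fgl_add a f g = fgl_add a g f.
Proof.
move=> aC; apply: fpsP => m /=; rewrite [fps_coef f m + _]addrC exchange_big /=.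
congr (_ + _); apply: eq_bigr => i _; apply: eq_bigr => j _.
by rewrite aC -!fps_coefM [f ^+ _ * _]mulrC.
Qed.

Lemma fgl_add_coef_le1 f g m :
  fps_coef f mone = 0 -> fps_coef g mone = 0 -> (mdeg m <= 1)%N ->
  fps_coef (fgl_add a f g) m = fps_coef f m + fps_coef g m.
Proof.
move=> f0 g0 m_le1 /=; rewrite big1 ?addr0 // => -[i lt_i] _.
rewrite big1 // => -[j lt_j] _ /=.
(* In degree at most 1 the only possible correction term is a multiple of [f * g], which starts in
   degree 2. *)
have -> : i = 0%N by lia.
have -> : j = 0%N by lia.
rewrite !expr1 big1_seq ?mulr0 // => -[p q] /=.
rewrite mem_mfact /= => /eqP pq.
have : (mdeg p == 0) || (mdeg q == 0) by move: m_le1; rewrite -pq mdegM; lia.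
by rewrite !mdeg_eq0 => /orP[]/eqP->; rewrite ?f0 ?g0 ?mul0r ?mulr0.
Qed.

Lemma fgl_sub_fpsX_lreg i j : i != j ->
  GRing.lreg (fgl_add a (fpsX i) (fgl_opp a (fpsX j)) : {fps R[I]}).
Proof.
move=> i_j.
have X0 k : fps_coef (fpsX k : {fps R[I]}) mone = 0.
  by rewrite /= eq_sym cm1_eq1.
have [N0 XN] := fgl_oppP a (X0 j).
(* Compare the coefficients of [X_i] in [X_j +_F \bar X_j = 0], where [X_j] contributes none. *)
have N_i : fps_coef (fgl_opp a (fpsX j) : {fps R[I]}) (ucm i) = 0.
  have := fgl_add_coef_le1 _ _ (ucm i) (X0 j) N0.
  rewrite mdegU XN => /(_ isT) /= /esym; suff -> : ucm i == ucm j = false.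
    by rewrite add0r.
  apply/eqP => /(congr1 (fun m : {cmonom I} => m i)).
  by rewrite !cmU eqxx eq_sym (negPf i_j).
by apply: (@fps_lreg _ _ i); rewrite fgl_add_coef_le1 ?mdeg1 ?mdegU ?N0 ?N_i
   ?X0 ?addr0 //= eqxx.
Qed.

End FormalSumTheory.

Lemma lazard_coefC i j : lazard_coef i j = lazard_coef j i.
Proof.
apply/eqP; rewrite -Quotient.idealrBE; apply/asboolP.
rewrite -[_ - _]mul1r -[_ * _]addr0; apply: FglIdealD; last exact: FglIdeal0.
exact: FglComm.
Qed.

Section Factorization.
Variables (n : nat) (I : choiceType) (x : 'I_n -> {fps lazard[I]}).
Variable b : nat -> {fps lazard[I]}.
Hypothesis x_reg : forall i j, i != j -> GRing.lreg (x i -_F x j).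
Implicit Types (lam mu : seq nat) (w : 'S_n).

Lemma hl_kernel_perm r w : (n.-1 <= r)%N ->
  hl_kernel r (x \o w) =
  (\prod_(i < n) \prod_(j < n | (i < j)%N) (x i +_F x j))%:F /
  (\prod_(i < n) \prod_(j < n | (i < j)%N) ((x \o w) i -_F (x \o w) j))%:F.
Proof.
move=> le_r.
rewrite -(@prod_ltn_perm _ n (fun i j => x i +_F x j) w); last first.
  by move=> i j; apply/fgl_addC/lazard_coefC.
have x_unit (i j : 'I_n) : (i < j)%N ->
    ((x \o w) i -_F (x \o w) j)%:F \is a GRing.unit.
  move=> i_j; apply/tofrac_unit/x_reg; rewrite (inj_eq perm_inj).
  by rewrite -val_eqE ltn_eqF.
rewrite !rmorph_prod -prodrV; last first.
  by move=> i _; rewrite rmorph_prod; apply: unitr_prod => j;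
     apply: x_unit.
rewrite -big_split /hl_kernel big_mkcond; apply: eq_bigr => i _ /=.
case: ifP => [_|i_r].
  rewrite !rmorph_prod -prodrV -?big_split //.
  by move=> j; apply: x_unit.
(* A row omitted from the kernel has [n.-1 <= i], so it is the last one and has no [j > i]. *)
rewrite !big_pred0 ?rmorph1 ?divr1 // => j; have := ltn_ord j; lia.
Qed.

(** The length of [mu] may be [n.-1] or [n], according to its last entry; the factorial is [1] in
    both cases. *)
Lemma univP_factor lam mu :
  (forall i, (i < n)%N -> nth 0%N mu i = nth 0%N (padd lam (rho n.-1)) i) ->
  univP mu x b =
  (\prod_(i < n) \prod_(j < n | (i < j)%N) (x i +_F x j))%:F * univs lam x b.
Proof.
move=> muE; have le_len : (n.-1 <= plength mu)%N.
  apply: leq_plength => i i_n.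
  by rewrite muE ?nth_padd ?nth_rho; lia.
have -> : univP mu x b = \sum_(w : 'S_n)
    (fpows b (x \o w) mu)%:F * hl_kernel (plength mu) (x \o w).
  rewrite /univP; have : (n - plength mu <= 1)%N by lia.
  by case: (n - plength mu)%N => [|[]] //; rewrite invr1 mul1r.
rewrite mulr_sumr; apply: eq_bigr => w _; rewrite hl_kernel_perm // mulrCA.
by congr (_ * (_ / _)); congr (_%:F); apply: eq_bigr => i _; rewrite muE.
Qed.

Lemma univQ_factor lam mu :
  (forall i, (i < n)%N -> nth 0%N mu i = (nth 0%N (padd lam (rho n.-1)) i).+1) ->
  univQ mu x b =
  (\prod_(i < n) \prod_(j < n | (i <= j)%N) (x i +_F x j))%:F * univs lam x b.
Proof.
move=> muE; have le_len : (n <= plength mu)%N.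
  by apply: leq_plength => i i_n; rewrite muE.
have -> : univQ mu x b = \sum_(w : 'S_n)
    (dfpows b (x \o w) mu)%:F * hl_kernel (plength mu) (x \o w).
  by rewrite /univQ (eqP (le_len : _ == _)) invr1 mul1r.
have -> : \prod_(i < n) \prod_(j < n | (i <= j)%N) (x i +_F x j) =
    \prod_(i < n) (x i +_F x i) *
    \prod_(i < n) \prod_(j < n | (i < j)%N) (x i +_F x j).
  rewrite -big_split; apply: eq_bigr => i _; rewrite (bigD1 i) //=.
  by congr (_ * _); apply: eq_bigl => j; rewrite ltn_neqAle andbC eq_sym.
rewrite mulr_sumr; apply: eq_bigr => w _.
rewrite hl_kernel_perm ?(leq_trans (leq_pred n)) //.
have -> : dfpows b (x \o w) mu =
    \prod_(i < n) (x i +_F x i) * fpows b (x \o w) (padd lam (rho n.-1)).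
  (* The diagonal product is symmetric, so it may be rewritten in the permuted variables and matched
     factor by factor. *)
  rewrite (reindex_inj (@perm_inj _ w)) -big_split; apply: eq_bigr => i _.
  by rewrite muE.
by rewrite !rmorphM -!mulrA; congr (_ * _); rewrite mulrCA.
Qed.

Lemma univPQ_factor lam : (0 < n)%N ->
  univP (padd (rho n.-1) lam) x b =
    (\prod_(i < n) \prod_(j < n | (i < j)%N) (x i +_F x j))%:F * univs lam x b /\
  univQ (padd (rho n) lam) x b =
    (\prod_(i < n) \prod_(j < n | (i <= j)%N) (x i +_F x j))%:F * univs lam x b.
Proof.
move=> n_gt0.
split; [apply: univP_factor | apply: univQ_factor] => i i_n;
  rewrite !nth_padd !nth_rho; lia.
Qed.

End Factorization.

Lemma padd_nil lam : padd lam [::] = lam.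
Proof.
apply: (@eq_from_nth _ 0%N) => [|i _]; first by rewrite size_mkseq maxn0.
by rewrite nth_padd nth_nil addn0.
Qed.

Theorem proposition4p19 (n : nat) (n_gt0 : (0 < n)%N) :
  (univP (rho n.-1) (@xvar n) (@bvar n) =
     (\prod_(i < n) \prod_(j < n | (i < j)%N) (xvar i +_F xvar j))%:F *
     univs [::] (@xvar n) (@bvar n) /\
   univQ (rho n) (@xvar n) (@bvar n) =
     (\prod_(i < n) \prod_(j < n | (i <= j)%N) (xvar i +_F xvar j))%:F *
     univs [::] (@xvar n) (@bvar n)) /\
  (forall lam : n.-tuple nat, sorted geq lam ->
     univP (padd (rho n.-1) lam) (@xvar n) (@bvar n) =
       (\prod_(i < n) \prod_(j < n | (i < j)%N) (xvar i +_F xvar j))%:F *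
       univs lam (@xvar n) (@bvar n) /\
     univQ (padd (rho n) lam) (@xvar n) (@bvar n) =
       (\prod_(i < n) \prod_(j < n | (i <= j)%N) (xvar i +_F xvar j))%:F *
       univs lam (@xvar n) (@bvar n)).
Proof.
have x_reg (i j : 'I_n) : i != j -> GRing.lreg (xvar i -_F xvar j).
  by move=> i_j; apply: fgl_sub_fpsX_lreg; rewrite (inj_eq (@inl_inj _ _)).
split=> [|lam _]; last exact: univPQ_factor.
(* The first part is the case of the empty partition. *)
by have := @univPQ_factor _ _ _ (@bvar n) x_reg [::] n_gt0; rewrite !padd_nil.
Qed.
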